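(* Let $k\in\mathbb{N}$ be odd, $m\in\mathbb{N}$ be even, and let $h_1,\ldots,h_m\in\mathbb{Z}$ with $\gcd(h_j,k)=1$ for $1\le j\le m$. For each $j$ let $h_j'$ satisfy $h_jh_j'\equiv 1\pmod k$. Define $$B(h_1,\ldots,h_m;k):=\sum_{\substack{a_1,\ldots,a_m \ (\mathrm{mod}\ k)\\ a_1\not\equiv 0\ (\mathrm{mod}\ k)\\ a_1+\cdots+a_m\equiv 0\ (\mathrm{mod}\ k)}} (-1)^{a_1h_1+k\lfloor a_1h_1/k\rfloor}\left(\left(\frac{a_2h_2}{k}\right)\right)\cdots\left(\left(\frac{a_mh_m}{k}\right)\right).$$ Then $$B(h_1,\ldots,h_m;k)=\frac{(-1)^{m/2}}{2^{m-1}k}\sum_{a=1}^{k-1}\tan\left(\frac{\pi a h_1'}{k}\right)\cot\left(\frac{\pi a h_2'}{k}\right)\cdots\cot\left(\frac{\pi a h_m'}{k}\right).$$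
   Context: For real $x$, $((x)):=\{x\}-\tfrac12$ if $x\notin\mathbb{Z}$ and $((x)):=0$ if $x\in\mathbb{Z}$, where $\{x\}=x-\lfloor x\rfloor$ is the fractional part. A sum over ''$a_1,\ldots,a_m\ (\mathrm{mod}\ k)$'' with congruence conditions means a sum over all $m$-tuples of residues modulo $k$ satisfying those conditions; note $(-1)^{a_1h_1+k\lfloor a_1h_1/k\rfloor}=(-1)^{r}$ where $r$ is the least nonnegative residue of $a_1h_1$ modulo $k$ (as $k$ is odd), so the summand does not depend on the choice of representatives. *)

(* Defs.v *)
From HB Require Import structures.
From mathcomp Require Import all_boot all_order all_algebra.
From mathcomp Require Import all_classical all_reals all_analysis.
Set Implicit Arguments.
Unset Strict Implicit.
Unset Printing Implicit Defensive.
Import Order.TTheory GRing.Theory Num.Theory.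
Local Open Scope ring_scope.

Definition frac_part (R : realType) (x : R) : R := x - (Num.floor x)%:~R.

Definition sawtooth (R : realType) (x : R) : R :=
  if x \is a Num.int then 0 else frac_part x - 2^-1.

Definition cot (R : realType) (x : R) : R := cos x / sin x.

(* The indices 1, ..., m are shifted to 0, ..., m - 1, so that the
   distinguished first index is [Ordinal m_gt0]. Residue classes modulo k are
   represented by their least nonnegative representatives, in ['I_k]; ['Z_k]
   would be wrong for k = 1. *)
Definition Bsum (R : realType) (m : nat) (m_gt0 : (0 < m)%N)
    (h : 'I_m -> int) (k : nat) : R :=
  let i1 := Ordinal m_gt0 in
  \sum_(a : {ffun 'I_m -> 'I_k} |
        (a i1 != 0 %[mod k])%N && (\sum_(j < m) a j == 0 %[mod k])%N)
    (-1) ^ ((a i1)%:Z * h i1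
            + k%:Z * Num.floor (((a i1)%:Z * h i1)%:~R / k%:R : R))
    * \prod_(j < m | j != i1) sawtooth (((a j)%:Z * h j)%:~R / k%:R : R).

(* Main.v *)
(* Finite Fourier analysis on Z/k. With w = exp(2 i pi / k), the constraint
   a_1 + ... + a_m = 0 (mod k) is detected by (1/k) sum_t w^(- t (a_1 + ... + a_m)),
   so that B is (1/k) times the sum over t of the product of the transforms at t of
   the m factors. The transform at n of r |-> (-1)^r (0 < r < k, extended by 0 at 0)
   is the geometric sum (1 - w^-n) / (1 + w^-n) = i tan (pi n / k), and that of
   ((r / k)) is (i / 2) cot (pi n / k); multiplying the argument by h_j dilates n
   by h_j'. The term t = 0 vanishes because of the tangent. *)
Require Import Defs.
From HB Require Import structures.
From mathcomp Require Import all_boot all_order all_algebra.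
From mathcomp Require Import all_classical all_reals all_analysis.
From mathcomp Require Import complex.
From mathcomp Require Import ring lra.
Import Order.TTheory GRing.Theory Num.Theory.
Local Open Scope ring_scope.

(** * Complex exponentials and roots of unity of order [k] *)

Definition cis {R : realType} (x : R) : R[i] := (cos x +i* sin x)%C.

Lemma cis0 (R : realType) : cis (0 : R) = 1.
Proof. by rewrite /cis cos0 sin0. Qed.

Lemma cisD (R : realType) (x y : R) : cis (x + y) = cis x * cis y.
Proof. by rewrite /cis cosD sinD; apply/eqP; rewrite eq_complex /= eqxx addrC /=. Qed.

Lemma cisMn (R : realType) (x : R) n : cis (x *+ n) = cis x ^+ n.
Proof. by elim: n => [|n IHn]; rewrite ?cis0 // mulrS exprS cisD IHn. Qed.

Lemma cis_2pi_int (R : realType) (n : int) : cis (2 * (pi * n%:~R) : R) = 1.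
Proof.
have cis_nat (p : nat) : cis (2 * (pi * p%:R) : R) = 1.
  rewrite mulrA [2 * pi]mulr_natl mulr_natr cisMn /cis cos2pi mulr2n sinD sinpi.
  by rewrite mul0r mulr0 addr0 expr1n.
case: n => p; first exact: cis_nat.
rewrite -[LHS]mulr1 -(cis_nat p.+1) -cisD NegzE mulrNz.
by rewrite -mulrDr -mulrDr addNr mulr0 mulr0 cis0.
Qed.

(* With w = exp(2 i pi / k), this is w ^ (- n). *)
Definition unityroot (R : realType) (k : nat) (n : int) : R[i] :=
  cis (- (2 * (pi * n%:~R / k%:R))).

Lemma unityroot0 (R : realType) k : unityroot R k 0 = 1.
Proof. by rewrite /unityroot mulr0 mul0r mulr0 oppr0 cis0. Qed.

Lemma unityrootD (R : realType) k x y :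
  unityroot R k (x + y) = unityroot R k x * unityroot R k y.
Proof. by rewrite /unityroot -cisD intrD mulrDr [_ / _]mulrDl mulrDr opprD. Qed.

Lemma unityrootMn (R : realType) k x (n : nat) :
  unityroot R k (x * n%:Z) = unityroot R k x ^+ n.
Proof.
elim: n => [|n IHn]; first by rewrite mulr0 unityroot0.
by rewrite exprS -IHn -unityrootD intS mulrDr mulr1.
Qed.

Lemma unityroot_kM (R : realType) k x : (0 < k)%N -> unityroot R k (x * k%:Z) = 1.
Proof.
move=> k_gt0; rewrite /unityroot intrM -[k%:Z%:~R]/(k%:R) [pi * _]mulrA mulfK ?pnatr_eq0 -?lt0n //.
by rewrite -mulrN -mulrN -mulrNz cis_2pi_int.
Qed.

Lemma unityroot_mod (R : realType) k x : (0 < k)%N ->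
  unityroot R k (x %% k)%Z = unityroot R k x.
Proof.
move=> k_gt0; rewrite [in RHS](divz_eq x k).
by rewrite (unityrootD _ _ (_ * _)) unityroot_kM // mul1r.
Qed.

Lemma unityroot_prod (R : realType) k (I : finType) (F : I -> int) :
  unityroot R k (\sum_i F i) = \prod_i unityroot R k (F i).
Proof. exact: (big_morph _ (unityrootD R k) (unityroot0 R k)). Qed.

(** For the converse, reduce [x] to its residue r. If 0 < r < k, the half angle t = pi r / k lies
    strictly between 0 and pi, so sin t > 0, whereas cos (2 t) = 1 would force sin t = 0. *)
Lemma unityroot_eq1 (R : realType) k x : (0 < k)%N ->
  (unityroot R k x == 1) = (k %| x)%Z.
Proof.
move=> k_gt0; apply/idP/idP; last by case/dvdzP=> q ->; rewrite unityroot_kM.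
have k_neq0 : k%:Z != 0 by rewrite -lt0n.
rewrite -unityroot_mod // (sameP dvdz_mod0P eqP).
have : 0 <= (x %% k)%Z < k%:Z by rewrite modz_ge0 // ltz_pmod.
case: (x %% k)%Z => // -[//|r]; rewrite ltz_nat => /andP[_ ltrk].
set t : R := pi * (Posz r.+1)%:~R / k%:R.
have t_itv : 0 < t < pi.
  rewrite /t divr_gt0 ?mulr_gt0 ?pi_gt0 ?ltr0n //=.
  by rewrite ltr_pdivrMr ?ltr0n // ltr_pM2l ?pi_gt0 // ltr_nat.
rewrite /unityroot -/t /cis cosN mulr_natl cos_mulr2n eq_complex /= => /andP[/eqP c1 _].
have := sin_gt0_pi t_itv; have := cos2Dsin2 t; nra.
Qed.

(** Orthogonality of characters: the geometric sum of a root w other than 1 is killed by the factor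
    w - 1, since w^k = 1. *)
Lemma unityroot_sum (R : realType) k x : (0 < k)%N ->
  \sum_(t < k) unityroot R k (x * t%:Z) = (k %| x)%Z%:R * k%:R.
Proof.
move=> k_gt0; under eq_bigr do rewrite unityrootMn.
rewrite -(unityroot_eq1 R) //; have [->|w_neq1] := eqVneq.
  by under eq_bigr do rewrite expr1n; rewrite sumr_const card_ord mul1r.
apply/(mulfI (_ : unityroot R k x - 1 != 0)); first by rewrite subr_eq0.
by rewrite -subrX1 -unityrootMn unityroot_kM // subrr mul0r mulr0.
Qed.

(** * The sign and the sawtooth as functions of residues modulo [k] *)

Lemma floor_divz (R : realType) k x : (0 < k)%N ->
  Num.floor (x%:~R / k%:R : R) = (x %/ k)%Z.
Proof.
move=> k_gt0; apply: floor_def; rewrite ler_pdivlMr ?ltr_pdivrMr ?ltr0n //.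
rewrite -![_ * k%:R](intrM _ _ k%:Z) ler_int ltr_int.
have k_gt0z : 0 < k%:Z by rewrite ltz_nat.
by rewrite {2 3}(divz_eq x k) mulrDl mul1r lerDl ltrD2l modz_ge0 ?ltz_pmod ?gt_eqF.
Qed.

(** The value 0 at multiples of [k] absorbs the condition on the first index, so that this index can
    range over all residues like the others. *)
Definition altsign (R : realType) (k : nat) (x : int) : R :=
  if (k %| x)%Z then 0 else (-1) ^ (x + k%:Z * Num.floor (x%:~R / k%:R : R)).

(** Writing x = q k + r, the exponent x + k q equals r + 2 k q, so only the parity of r matters. *)
Lemma altsignE (R : realType) k x : odd k ->
  altsign R k x = if (k %| x)%Z then 0 else (-1) ^+ `|(x %% k)%Z|.
Proof.
move=> k_odd; have k_gt0 := odd_gt0 k_odd; rewrite /altsign floor_divz //.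
case: ifP => // _.
have -> : x + k%:Z * (x %/ k)%Z = (x %% k)%Z + 2 * (k%:Z * (x %/ k)%Z).
  by rewrite {1}(divz_eq x k); ring.
rewrite expfzDr ?oppr_eq0 ?oner_eq0 // -exprz_exp -[(-1) ^ 2]exprnP sqrrN !expr1n exp1rz mulr1.
by rewrite -[in LHS](gez0_abs (modz_ge0 _ _)) // -lt0n.
Qed.

Lemma sawtoothE (R : realType) k x : (0 < k)%N ->
  sawtooth (x%:~R / k%:R : R) =
  if (k %| x)%Z then 0 else `|(x %% k)%Z|%:R / k%:R - 2^-1.
Proof.
move=> k_gt0.
have k_neq0 : k%:R != 0 :> R by rewrite pnatr_eq0 -lt0n.
have fracE : frac_part (x%:~R / k%:R : R) = `|(x %% k)%Z|%:R / k%:R.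
  rewrite /frac_part floor_divz // [`|_|%:R]pmulrn gez0_abs ?modz_ge0 -?lt0n //.
  apply: (mulIf k_neq0); rewrite mulrBl !divfK //.
  by rewrite {1}(divz_eq x k) intrD intrM addrAC subrr add0r.
rewrite /sawtooth fracE; congr (if _ then _ else _).
apply/intrP/idP => [[q /(congr1 ( *%R^~ k%:R))]|/dvdzP[q ->]].
  by rewrite divfK // -[_ * k%:R](intrM _ _ k%:Z) => /intr_inj ->; rewrite dvdz_mull.
by exists q; rewrite intrM mulfK.
Qed.

Lemma dvdz_mod (d x : int) : (d %| x %% d)%Z = (d %| x)%Z.
Proof. by rewrite !(sameP dvdz_mod0P eqP) modz_mod. Qed.

Lemma altsign_mod (R : realType) k x : odd k ->
  altsign R k (x %% k)%Z = altsign R k x.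
Proof. by move=> k_odd; rewrite !altsignE // modz_mod dvdz_mod. Qed.

Lemma sawtooth_mod (R : realType) k x : (0 < k)%N ->
  sawtooth ((x %% k)%Z%:~R / k%:R : R) = sawtooth (x%:~R / k%:R).
Proof. by move=> k_gt0; rewrite !sawtoothE // modz_mod dvdz_mod. Qed.

(** * Fourier transforms of the sign and of the sawtooth *)

(* That is, (1 - z) / (1 + z) = i tan x for z = exp(- 2 i x). *)
Lemma cis_half_angle (R : realType) (x : R) :
  (1 - cis (- (2 * x))) * (cos x)%:C%C = 'i%C * (sin x)%:C%C * (1 + cis (- (2 * x))).
Proof.
rewrite /cis cosN sinN [2 * x]mulr_natl cos_mulr2n sin_mulr2n.
have := cos2Dsin2 x; move: (cos x) (sin x) => c s cs.
have s2 : s ^+ 2 = 1 - c ^+ 2 by rewrite -cs; ring.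
by apply/eqP; rewrite eq_complex /=; apply/andP; split; apply/eqP; ring: s2.
Qed.

Lemma unityrootXk (R : realType) k n : (0 < k)%N -> unityroot R k n ^+ k = 1.
Proof. by move=> k_gt0; rewrite -unityrootMn unityroot_kM. Qed.

(** For odd [k] the number -1 has [k]-th power -1, so it is not a [k]-th root of unity. *)
Lemma unityroot_neqN1 (R : realType) k n : odd k -> 1 + unityroot R k n != 0.
Proof.
move=> k_odd; apply/eqP => /eqP; rewrite addrC addr_eq0 => /eqP w_eq.
have := unityrootXk R k n (odd_gt0 k_odd).
rewrite w_eq -signr_odd k_odd expr1 => /eqP.
by rewrite eq_sym -addr_eq0 -mulr2n pnatr_eq0.
Qed.

Lemma dvdz_ord k (b : 'I_k) : (k %| b%:Z)%Z = (b == 0 :> nat).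
Proof. by rewrite dvdzE /= /dvdn modn_small. Qed.

(** The full geometric sum of ratio -w is 2 / (1 + w), because (-w)^k = -1 for odd [k]. Removing the
    term at 0 leaves (1 - w) / (1 + w), to which the half-angle identity applies. *)
Lemma altsign_sum (R : realType) k n : odd k ->
  \sum_(b < k) (altsign R k b)%:C%C * unityroot R k (n * b%:Z) =
  'i%C * (tan (pi * n%:~R / k%:R))%:C%C.
Proof.
move=> k_odd; have k_gt0 := odd_gt0 k_odd.
set w := unityroot R k n.
have w1 : 1 + w != 0 := unityroot_neqN1 R k n k_odd.
(* The final -1 removes the term b = 0, where [altsign] is 0 but the power is 1. *)
have sumE : \sum_(b < k) (altsign R k b)%:C%C * unityroot R k (n * b%:Z) =
    \sum_(b < k) (- w) ^+ b - 1.
  under eq_bigr => b _ do rewrite altsignE // dvdz_ord unityrootMn -/w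
    modz_small ?ltz_nat //=.
  case: (k) k_gt0 => // k' _; rewrite !big_ord_recl /= mul0r add0r expr0 (addrC 1) addrK.
  apply: eq_bigr => b _; rewrite [RHS]exprNn; congr (_ * _).
  by rewrite rmorphXn rmorphN rmorph1.
have wN : \sum_(b < k) (- w) ^+ b = 2 / (1 + w).
  apply: (canRL (mulfK w1)); rewrite mulrC -[1 + w]opprK mulNr opprD [-1 - w]addrC.
  by rewrite -subrX1 exprNn unityrootXk // -signr_odd k_odd expr1; ring.
have := cis_half_angle R (pi * n%:~R / k%:R : R); rewrite -/(unityroot R k n) -/w.
rewrite sumE wN /tan; set c := cos _; set s := sin _ => half.
(* The tangent is a genuine quotient: a zero cosine would, by the half-angle identity and 1 + w !=
   0, make the sine vanish too. *)
have c0 : c%:C%C != 0.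
  apply/eqP => c0; have := half; rewrite c0 mulr0 => /esym/eqP.
  rewrite !mulf_eq0 (negPf w1) orbF complexiE (negPf (neq0Ci _)) /= => /eqP/(@complexI R) s0.
  have /eqP := cos2Dsin2 (pi * n%:~R / k%:R : R).
  rewrite -/c -/s s0; move/(@complexI R): c0 => ->.
  by rewrite expr0n addr0 eq_sym oner_eq0.
rewrite rmorphM fmorphV; apply: (mulIf c0); apply: (mulIf w1).
rewrite !mulrA mulfVK // -half; by field.
Qed.

(** Summation by parts. When w^n = 1 and w != 1 it gives n / (w - 1) for the sum of b w^b. *)
Lemma sum_natMX (F : fieldType) (w : F) n :
  (w - 1) * (\sum_(b < n) b%:R * w ^+ b) = n%:R * w ^+ n - w * \sum_(b < n) w ^+ b.
Proof.
elim: n => [|n IHn]; first by rewrite !big_ord0; ring.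
by rewrite !big_ord_recr /= mulrDr IHn -natr1 exprS; ring.
Qed.

(** The part b / k contributes 1 / (w - 1), the constant -1/2 sums to 0, and the correction at b = 0
    adds 1/2. The total (w + 1) / (2 (w - 1)) is a cotangent by the half-angle identity. *)
Lemma sawtooth_sum (R : realType) k n : (0 < k)%N -> ~~ (k %| n)%Z ->
  \sum_(b < k) (sawtooth (b%:Z%:~R / k%:R : R))%:C%C * unityroot R k (n * b%:Z) =
  'i%C / 2 * (cot (pi * n%:~R / k%:R))%:C%C.
Proof.
move=> k_gt0 ndvd.
set w := unityroot R k n.
have w1 : w - 1 != 0 by rewrite subr_eq0 unityroot_eq1.
have k0 : k%:R != 0 :> R[i] by rewrite pnatr_eq0 -lt0n.
have sumw0 : \sum_(b < k) w ^+ b = 0.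
  by apply: (mulfI w1); rewrite -subrX1 unityrootXk // subrr mulr0.
have sumbw : \sum_(b < k) b%:R * w ^+ b = k%:R / (w - 1).
  apply: (canRL (mulfK w1)).
  by rewrite mulrC sum_natMX sumw0 unityrootXk // mulr0 mulr1 subr0.
(* The last 1/2 compensates for b = 0, where the sawtooth is 0 and not -1/2. *)
have sumE : \sum_(b < k) (sawtooth (b%:Z%:~R / k%:R : R))%:C%C * unityroot R k (n * b%:Z) =
    k%:R^-1 * (\sum_(b < k) b%:R * w ^+ b) - 2^-1 * (\sum_(b < k) w ^+ b) + 2^-1.
  under eq_bigr => b _ do rewrite sawtoothE // dvdz_ord unityrootMn -/w
    modz_small ?ltz_nat //=.
  rewrite !mulr_sumr -sumrB.
  case: (k) k_gt0 => // k' _; rewrite !big_ord_recl /= expr0; set s1 := \sum_(i < k') _.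
  set s2 := \sum_(i < k') _; suff -> : s1 = s2 by ring.
  apply: eq_bigr => b _; rewrite rmorphB rmorphM !fmorphV !rmorph_nat; ring.
have := cis_half_angle R (pi * n%:~R / k%:R : R); rewrite -/(unityroot R k n) -/w.
rewrite sumE sumbw sumw0 /cot; set c := cos _; set s := sin _ => half.
have s0 : s%:C%C != 0.
  apply/eqP => s0; have := half; rewrite s0 mulr0 mul0r => /eqP.
  rewrite !mulf_eq0 -oppr_eq0 opprB (negPf w1) /= => /eqP/(@complexI R) c0.
  have /eqP := cos2Dsin2 (pi * n%:~R / k%:R : R).
  rewrite -/c -/s c0; move/(@complexI R): s0 => ->.
  by rewrite expr0n addr0 eq_sym oner_eq0.
rewrite rmorphM fmorphV; apply: (mulIf s0); apply: (mulIf w1).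
have i2 : 'i%C * 'i%C = -1 :> R[i] by rewrite -expr2 sqr_i.
rewrite !mulrA mulfVK //.
(* Bring out (1 - w) c, the left side of the half-angle identity [half], so that the cosine can be
   exchanged for the sine. *)
have -> : 'i%C / 2 * c%:C%C * (w - 1) = - 'i%C / 2 * ((1 - w) * c%:C%C) by ring.
have -> : - 'i%C / 2 * ((1 - w) * c%:C%C) = - ('i%C * 'i%C) / 2 * s%:C%C * (1 + w).
  by rewrite half; ring.
by rewrite i2; field; rewrite ?w1 ?k0 ?pnatr_eq0.
Qed.

(** * Dilation, and detection of the congruence condition *)

(** Substitute b h' for b: multiplication by h' permutes the residues, and h' h = 1 modulo [k]
    cancels the dilation inside [F]. *)
Lemma sum_unityroot_dilate (R : realType) k (F : int -> R[i]) (h h' n : int) :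
    (0 < k)%N -> (forall x, F (x %% k)%Z = F x) -> (h * h' = 1 %[mod k])%Z ->
  \sum_(b < k) F (b%:Z * h) * unityroot R k (n * b%:Z) =
  \sum_(b < k) F b%:Z * unityroot R k (n * h' * b%:Z).
Proof.
case: k => // k _ Fmod hh'.
have k_neq0 : k.+1%:Z != 0 by [].
pose f (b : 'I_k.+1) : 'I_k.+1 := inord `|(b%:Z * h' %% k.+1)%Z|%N.
have fE b : (f b)%:Z = (b%:Z * h' %% k.+1)%Z.
  rewrite /f inordK ?gez0_abs ?modz_ge0 //.
  by rewrite -ltz_nat gez0_abs ?modz_ge0 // ltz_pmod.
have fK (b : 'I_k.+1) : ((f b)%:Z * h = b%:Z %[mod k.+1])%Z.
  by rewrite fE modzMml -mulrA [h' * h]mulrC -modzMmr hh' modzMmr mulr1.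
(* By [fK], multiplication by [h] recovers b from [f b]. An injection of a finite type into itself
   is enough to reindex. *)
have f_inj : injective f.
  move=> b c fbc; have := fK b; rewrite fbc fK !modz_small ?ltz_nat ?ltn_ord //.
  by case=> /esym/val_inj.
rewrite (reindex_inj f_inj); apply: eq_bigr => b _.
rewrite -Fmod fK Fmod; congr (_ * _).
rewrite -unityroot_mod // fE modzMmr unityroot_mod //; congr unityroot; ring.
Qed.

(** Expanding the product of sums on the right and exchanging with the sum over t leaves, for each
    tuple, the sum over t of a character at the sum of its entries; by orthogonality this is [k] or
    0. *)
Lemma sum_prod_dvd (R : realType) k m (F : 'I_m -> int -> R[i]) : (0 < k)%N ->
  \sum_(a : {ffun 'I_m -> 'I_k} | (k %| \sum_(j < m) a j)%N) \prod_(j < m) F j (a j)%:Z =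
  k%:R^-1 * \sum_(t < k) \prod_(j < m) \sum_(b < k) F j b%:Z * unityroot R k (t%:Z * b%:Z).
Proof.
move=> k_gt0; have k_neq0 : k%:R != 0 :> R[i] by rewrite pnatr_eq0 -lt0n.
apply: (canRL (mulKf k_neq0)).
under [RHS]eq_bigr => t _ do rewrite bigA_distr_bigA /=.
rewrite exchange_big /= mulr_sumr big_mkcond; apply: eq_bigr => a _.
under [RHS]eq_bigr => t _ do rewrite big_split /= -unityroot_prod -mulr_sumr mulrC.
rewrite -mulr_suml -mulrC.
have -> : \sum_(j < m) (a j)%:Z = (\sum_(j < m) a j)%N%:Z.
  by rewrite (big_morph Posz PoszD (erefl _)).
under [X in _ = X * _]eq_bigr => t _ do rewrite mulrC.
rewrite unityroot_sum // dvdzE /=; case: ifP => _; by rewrite ?mul1r ?mul0r ?mulr0 // mulrC.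
Qed.

(** * Evaluation of [Bsum] *)

(** Since the first [h] is coprime to [k], its product with the first entry is divisible by [k]
    exactly when that entry is, and [altsign] then vanishes. *)
Lemma Bsum_altsign (R : realType) m (m_gt0 : (0 < m)%N) (h : 'I_m -> int) k :
    odd k -> (forall j, coprimez (h j) k%:Z) ->
  let i1 := Ordinal m_gt0 in
  Bsum R m_gt0 h k =
  \sum_(a : {ffun 'I_m -> 'I_k} | (k %| \sum_(j < m) a j)%N)
    \prod_(j < m) (if j == i1 then altsign R k ((a j)%:Z * h j)
                   else sawtooth (((a j)%:Z * h j)%:~R / k%:R : R)).
Proof.
move=> k_odd hk i1; rewrite /Bsum -/i1.
have mod0E n : (n == 0 %[mod k])%N = (k %| n)%N by rewrite mod0n.
under eq_bigl => a do rewrite !mod0E.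
rewrite big_mkcondl /=; apply: eq_bigr => a _.
rewrite [RHS](bigD1 i1) //= ?eqxx /altsign.
rewrite Gauss_dvdzl 1?coprimez_sym // dvdzE /=.
case: ifP => ndvd; last by rewrite (negbFE ndvd) mul0r.
rewrite (negPf ndvd); congr (_ * _).
by apply: eq_bigr => j /negPf ->.
Qed.

Theorem theorem5 (R : realType) (k m : nat) (m_gt0 : (0 < m)%N)
    (h h' : 'I_m -> int)
    (k_odd : odd k) (m_even : ~~ odd m)
    (h_coprime : forall j : 'I_m, coprimez (h j) k%:Z)
    (h'_inverse : forall j : 'I_m, (h j * h' j = 1 %[mod k%:Z])%Z) :
  Bsum R m_gt0 h k =
    (-1) ^+ (m %/ 2) / (2 ^+ (m - 1) * k%:R) *
    \sum_(1 <= a < k)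
      (tan (pi * a%:R * (h' (Ordinal m_gt0))%:~R / k%:R) *
       \prod_(j < m | j != Ordinal m_gt0)
         cot (pi * a%:R * (h' j)%:~R / k%:R)).
Proof.
set i1 := Ordinal m_gt0; have k_gt0 := odd_gt0 k_odd.
(* Needed later to see that t h'_j is not divisible by [k] for 0 < t < k. The Bezout relation is
   read off from h h' - 1 = q k. *)
have h'_coprime j : coprimez (h' j) k%:Z.
  apply/coprimezP; have /eqP := h'_inverse j; rewrite eqz_mod_dvd => /dvdzP[q hq].
  by exists (h j, - q) => /=; rewrite mulNr -hq opprB addrC subrK.
pose f j x : R := if j == i1 then altsign R k x else sawtooth (x%:~R / k%:R).
have f_mod j x : f j (x %% k)%Z = f j x.
  by rewrite /f altsign_mod // sawtooth_mod.
apply: (@complexI R).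
transitivity (\sum_(a : {ffun 'I_m -> 'I_k} | (k %| \sum_(j < m) a j)%N)
    \prod_(j < m) (f j ((a j)%:Z * h j))%:C%C).
  rewrite Bsum_altsign // rmorph_sum; apply: eq_bigr => a _.
  by rewrite rmorph_prod.
rewrite (sum_prod_dvd R k m (fun j x => (f j (x * h j))%:C%C)) //.
have dilate (t : 'I_k) j :
    \sum_(b < k) (f j (b%:Z * h j))%:C%C * unityroot R k (t%:Z * b%:Z) =
    \sum_(b < k) (f j b%:Z)%:C%C * unityroot R k (t%:Z * h' j * b%:Z).
  by apply: (sum_unityroot_dilate R k (fun x => (f j x)%:C%C)) => // x; rewrite f_mod.
under eq_bigr => t _ do under eq_bigr => j _ do rewrite dilate.
(* Split off t = 0, where [sawtooth_sum] does not apply; the tangent factor makes this term 0. *)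
rewrite -(big_mkord xpredT (fun t => \prod_(j < m) \sum_(b < k) (f j b%:Z)%:C%C
  * unityroot R k (t%:Z * h' j * b%:Z))) big_ltn //=.
rewrite [X in X + _](bigD1 i1) //= {1}/f ?eqxx mul0r altsign_sum // mulr0 mul0r.
rewrite tan0 mulr0 mul0r add0r rmorphM rmorph_sum !mulr_sumr.
apply: eq_big_nat => t /andP[t_gt0 ltk].
rewrite (bigD1 i1) //= {1}/f ?eqxx altsign_sum //.
have angleE j : pi * (t%:Z * h' j)%:~R / k%:R = pi * t%:R * (h' j)%:~R / k%:R :> R.
  by rewrite intrM mulrA.
have cotE j : j != i1 -> \sum_(b < k) (f j b%:Z)%:C%C * unityroot R k (t%:Z * h' j * b%:Z)
    = 'i%C / 2 * (cot (pi * t%:R * (h' j)%:~R / k%:R))%:C%C.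
  move=> /negPf jN; rewrite /f jN sawtooth_sum ?angleE // Gauss_dvdzl 1?coprimez_sym //.
  by rewrite dvdzE /= gtnNdvd.
rewrite (eq_bigr _ cotE) big_split /= prodr_const angleE.
rewrite cardC1 card_ord.
(* One factor i comes from the tangent and m - 1 factors i / 2 from the cotangents; since m is even,
   i^m = (-1)^(m/2). *)
have iE : 'i%C * ('i%C / 2) ^+ m.-1 = (-1) ^+ (m %/ 2) / 2 ^+ (m - 1) :> R[i].
  rewrite expr_div_n mulrA -exprS prednK // subn1 -sqr_i -exprM; congr (_ ^+ _ / _).
  by rewrite mulnC divnK // dvdn2.
have coefE : ((-1) ^+ (m %/ 2) / (2 ^+ (m - 1) * k%:R))%:C%C =
    k%:R^-1 * ('i%C * ('i%C / 2) ^+ m.-1) :> R[i].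
  rewrite iE rmorphM fmorphV rmorphM !rmorphXn rmorphN rmorph1 !rmorph_nat invfM.
  by rewrite mulrA mulrC.
rewrite coefE [X in _ = _ * X]rmorphM rmorph_prod /=.
by ring.
Qed.
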